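(* Let $A\in\mathbb{R}^{n\times n}$, $B\in\mathbb{R}^{n\times m}$ and $x_0\in\mathbb{R}^n$. If $(A,B)$ is stabilizable and $\mathcal{D}_N$ is the data set returned by the Fast exploration algorithm applied to the system $x_{k+1}=Ax_k+Bu_k$ with initial condition $x_0$, then the pseudo estimate $(\hat A_0(\mathcal{D}_N),\hat B_0(\mathcal{D}_N))$ is also stabilizable, and any controller gain $K\in\mathbb{R}^{m\times n}$ that stabilizes $(\hat A_0(\mathcal{D}_N),\hat B_0(\mathcal{D}_N))$ also stabilizes $(A,B)$.
   Context: System: $x_{k+1}=Ax_k+Bu_k$, discrete time, with state $x_k\in\mathbb{R}^n$, input $u_k\in\mathbb{R}^m$, $A\in\mathbb{R}^{n\times n}$, $B\in\mathbb{R}^{n\times m}$; $e_1,\dots,e_m$ are the standard unit vectors of $\mathbb{R}^m$. A matrix is stable if all its eigenvalues have modulus strictly less than $1$. A gain $K\in\mathbb{R}^{m\times n}$ (control law $u_k=Kx_k$) stabilizes $(A,B)$ if $A+BK$ is stable; $(A,B)$ is stabilizable if such a $K$ exists. Fast exploration algorithm. Given the initial state $x_0$, put $x_{-1}:=0$, $s:=1$, $k:=0$, $\mathcal{D}_0:=\emptyset$. Repeat: set $u_k:=0$. If $x_k\in\operatorname{span}\{x_{k-1},\dots,x_0,x_{-1}\}$, then: if $s>m$, stop and return $\mathcal{D}_k$; otherwise set $u_k:=e_s$ and increase $s$ by one. Then (if not stopped) let $x_{k+1}:=Ax_k+Bu_k$, $\mathcal{D}_{k+1}:=\mathcal{D}_k\cup\{(x_{k+1},x_k,u_k)\}$,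 and increase $k$ by one. $N$ denotes the value of $k$ at which the algorithm stops. Pseudo estimator. For a data set $\mathcal{D}_N=\{(x_k^+,x_k,u_k)\mid k=0,\dots,N-1\}$ with $x_k^+=Ax_k+Bu_k$, the pseudo estimate $(\hat A_0(\mathcal{D}_N),\hat B_0(\mathcal{D}_N))$ is the unique minimizer of $\|\hat A\|_F^2+\|\hat B\|_F^2$ (Frobenius norms) over all $(\hat A,\hat B)\in\mathbb{R}^{n\times n}\times\mathbb{R}^{n\times m}$ satisfying $x_k^+=\hat Ax_k+\hat Bu_k$ for $k=0,\dots,N-1$. Equivalently, $\begin{pmatrix}\hat A_0(\mathcal{D}_N)&\hat B_0(\mathcal{D}_N)\end{pmatrix}=X^+\begin{pmatrix}X \\ U\end{pmatrix}^{\dagger}$, where $X=(x_0\ \cdots\ x_{N-1})$, $X^+=(x_0^+\ \cdots\ x_{N-1}^+)$, $U=(u_0\ \cdots\ u_{N-1})$ and $(\cdot)^\dagger$ is the Moore–Penrose pseudoinverse. *)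

(* Defs.v *)
From HB Require Import structures.
From mathcomp Require Import all_boot all_order all_algebra.
From mathcomp Require Import complex.
From mathcomp Require Import boolp classical_sets reals.
From mathcomp Require Import zify.

Set Implicit Arguments.
Unset Strict Implicit.
Unset Printing Implicit Defensive.

Import Order.TTheory GRing.Theory Num.Theory.

Local Open Scope classical_set_scope.
Local Open Scope ring_scope.

(* The eigenvalues of a real matrix are taken in the complex numbers R[i]. *)
Definition stable (R : realType) (n : nat) (M : 'M[R]_n) : Prop :=
  forall z : R[i], eigenvalue (map_mx (real_complex R) M) z -> `|z| < 1.

Definition stabilizes (R : realType) (n m : nat)
    (A : 'M[R]_n) (B : 'M[R]_(n, m)) (K : 'M[R]_(m, n)) : Prop :=
  stable (A + B *m K).

Definition stabilizable (R : realType) (n m : nat)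
    (A : 'M[R]_n) (B : 'M[R]_(n, m)) : Prop :=
  exists K : 'M[R]_(m, n), stabilizes A B K.

(* A data point is a triple (x^+, x, u). *)
Definition datum (R : realType) (n m : nat) : Type :=
  ('cV[R]_n * 'cV[R]_n * 'cV[R]_m)%type.

(* [unit_vec R m s] is e_s with the index s counted from 1. *)
Definition unit_vec (R : realType) (m s : nat) : 'cV[R]_m :=
  \col_(i < m) (i.+1 == s)%:R.

(* The variables of the algorithm at time k: [expl_x] is x_k, [expl_past] is
   the list x_{k-1}, ..., x_0, x_{-1}, [expl_s] is s, [expl_data] is D_k. *)
Record exploration (R : realType) (n m : nat) : Type := Exploration {
  expl_x : 'cV[R]_n;
  expl_past : seq 'cV[R]_n;
  expl_s : nat;
  expl_data : set (datum R n m)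
}.

Definition exploration_init (R : realType) (n m : nat) (x0 : 'cV[R]_n) :
    exploration R n m :=
  Exploration x0 [:: 0] 1 set0.

Definition exploration_apply (R : realType) (n m : nat)
    (A : 'M[R]_n) (B : 'M[R]_(n, m)) (st : exploration R n m)
    (u : 'cV[R]_m) (s : nat) : exploration R n m :=
  let x := expl_x st in
  let xp := A *m x + B *m u in
  Exploration xp (x :: expl_past st) s (expl_data st `|` [set (xp, x, u)]).

(* One pass through the loop; [None] means that the algorithm stops. *)
Definition exploration_step (R : realType) (n m : nat)
    (A : 'M[R]_n) (B : 'M[R]_(n, m)) (st : exploration R n m) :
    option (exploration R n m) :=
  let s := expl_s st in
  if expl_x st \in <<expl_past st>>%VS then
    if (m < s)%N then None
    else Some (exploration_apply A B st (unit_vec R m s) s.+1)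
  else Some (exploration_apply A B st 0 s).

Inductive exploration_returns (R : realType) (n m : nat)
    (A : 'M[R]_n) (B : 'M[R]_(n, m)) :
    exploration R n m -> set (datum R n m) -> Prop :=
| Exploration_stop st :
    exploration_step A B st = None ->
    exploration_returns A B st (expl_data st)
| Exploration_continue st st' D :
    exploration_step A B st = Some st' ->
    exploration_returns A B st' D ->
    exploration_returns A B st D.

Definition fast_exploration (R : realType) (n m : nat)
    (A : 'M[R]_n) (B : 'M[R]_(n, m)) (x0 : 'cV[R]_n)
    (D : set (datum R n m)) : Prop :=
  exploration_returns A B (exploration_init m x0) D.

(* The algorithm always stops: each pass enlarges the span or increases s. *)
Lemma fast_exploration_terminates (R : realType) (n m : nat)
    (A : 'M[R]_n) (B : 'M[R]_(n, m)) (x0 : 'cV[R]_n) :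
  exists D, fast_exploration A B x0 D.
Proof.
rewrite /fast_exploration; move: (exploration_init m x0) => st.
have [f] := ubnP (m.+1 - expl_s st + (n - \dim <<expl_past st>>%VS))%N.
elim: f st => [//|f IHf] st lt_f.
case E: (exploration_step A B st) => [st'|]; last first.
  by exists (expl_data st); apply: Exploration_stop.
suff [D HD] : exists D, exploration_returns A B st' D.
  by exists D; apply: Exploration_continue HD.
apply: IHf; move: E; rewrite /exploration_step.
case: ifPn => xin.
  case: ltnP => // les [<-] /=.
  have : (\dim <<expl_past st>> <= \dim <<expl_x st :: expl_past st>>)%N.
    by rewrite dimvS // span_cons addvSr.
  lia.
move=> [<-] /=.
have lt_dim :
    (\dim <<expl_past st>> < \dim <<expl_x st :: expl_past st>>)%N.
  rewrite ltn_neqAle dimvS ?span_cons ?addvSr // andbT.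
  apply: contra xin => /eqP eq_dim.
  have /eqP -> : <<expl_past st>>%VS == (<[expl_x st]> + <<expl_past st>>)%VS.
    by rewrite eqEdim addvSr eq_dim leqnn.
  by rewrite memvE addvSl.
have : (\dim <<expl_x st :: expl_past st>> <= n)%N.
  by rewrite (leq_trans (dimvS (subvf _))) // dimvf /dim /= muln1.
lia.
Qed.

Definition frobenius_norm (R : realType) (p q : nat) (M : 'M[R]_(p, q)) : R :=
  Num.sqrt (\sum_(i < p) \sum_(j < q) M i j ^+ 2).

Definition consistent (R : realType) (n m : nat) (D : set (datum R n m))
    (AB : 'M[R]_n * 'M[R]_(n, m)) : Prop :=
  forall xp x u, D (xp, x, u) -> xp = AB.1 *m x + AB.2 *m u.

Definition least_norm_consistent (R : realType) (n m : nat)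
    (D : set (datum R n m)) (AB : 'M[R]_n * 'M[R]_(n, m)) : Prop :=
  consistent D AB /\
  forall AB' : 'M[R]_n * 'M[R]_(n, m), consistent D AB' ->
    frobenius_norm AB.1 ^+ 2 + frobenius_norm AB.2 ^+ 2
      <= frobenius_norm AB'.1 ^+ 2 + frobenius_norm AB'.2 ^+ 2.

(* The minimizer exists and is unique as soon as D is consistent with some
   pair (A, B); the default value (0, 0) is only used when there is none. *)
Definition pseudo_estimate (R : realType) (n m : nat)
    (D : set (datum R n m)) : 'M[R]_n * 'M[R]_(n, m) :=
  xget (0, 0) [set AB | least_norm_consistent D AB].

(* Main.v *)
Require Import Defs.
From HB Require Import structures.
From mathcomp Require Import all_boot all_order all_algebra.
From mathcomp Require Import complex.
From mathcomp Require Import boolp classical_sets reals.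

Set Implicit Arguments.
Unset Strict Implicit.
Unset Printing Implicit Defensive.

Import Order.TTheory GRing.Theory Num.Theory.

Local Open Scope classical_set_scope.
Local Open Scope ring_scope.

(** Let [V] be the span of the states visited when the algorithm stops. The
algorithm injects an input only when the current state is already spanned by
its predecessors, so that its free response is already determined by the data
and the step reveals the effect of the input alone.
Hence [V] is [A]-invariant and contains the range of [B], and the data
determine exactly [B] and the restriction of [A] to [V]: a pair is consistent
with the data if and only if its input matrix is [B] and its state matrix
agrees with [A] on [V] ([fast_exploration_informative]).

Let [P] be the orthogonal projection onto [V]. By Pythagoras, the matrix of
least Frobenius norm which agrees with [A] on [V] is [A *m P], so the pseudo
estimate is [(A *m P, B)] ([pseudo_estimate_projection]).

For any gain [K], both [A + B K] and [A P + B K] leave [V] invariant and they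
coincide on [V]. On the quotient by [V] the input has no effect: the first
matrix acts there as [A], the second one as 0. So the eigenvalues of
[A + B K] are those of [A P + B K], up to 0, together with the eigenvalues of
[A] on the quotient, which are stable whatever [K] is because some gain
stabilizes [(A, B)]. This gives both directions ([stabilizes_restrict] and
[stabilizes_extend]). The quotient is handled through eigenvectors: a left
eigenvector killing [V] is one of [A] on the quotient. *)

(** * Eigenvalues of a system with an invariant subspace *)

Lemma eigenvalue_trmx (F : fieldType) (n : nat) (M : 'M[F]_n) (a : F) :
  eigenvalue M^T a = eigenvalue M a.
Proof.
rewrite !eigenvalue_root_char /char_poly -[in RHS]det_tr /char_poly_mx.
by rewrite raddfB /= tr_scalar_mx map_trmx.
Qed.

Lemma right_eigenvalueP (F : fieldType) (n : nat) (M : 'M[F]_n) (a : F) :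
  reflect (exists2 v : 'cV_n, M *m v = a *: v & v != 0) (eigenvalue M a).
Proof.
rewrite -eigenvalue_trmx; apply: (iffP eigenvalueP) => -[v Mv nz_v].
  by exists v^T; rewrite ?trmx_eq0 // -[M]trmxK -trmx_mul Mv linearZ.
by exists v^T; rewrite ?trmx_eq0 // -trmx_mul Mv linearZ.
Qed.

(** The hypotheses on [P] say that its range is [A]-invariant and contains the
range of [B]. The range of [A *m P + B *m K] lies there too, so a (right)
eigenvector for a nonzero eigenvalue is fixed by [P], and on such vectors the
two closed loops agree. *)
Lemma eigenvalue_restrict (F : fieldType) (n m : nat) (A P : 'M[F]_n)
    (B : 'M[F]_(n, m)) (K : 'M[F]_(m, n)) (z : F) :
  P *m A *m P = A *m P -> P *m B = B -> z != 0 ->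
  eigenvalue (A *m P + B *m K) z -> eigenvalue (A + B *m K) z.
Proof.
move=> PAP PB nz_z /right_eigenvalueP[v zv nz_v].
have Pv : P *m v = v.
  apply: (scalerI nz_z); rewrite scalemxAr -zv mulmxA.
  by rewrite mulmxDr !mulmxA PAP PB.
apply/right_eigenvalueP; exists v => //.
by rewrite -zv !mulmxDl -(mulmxA A P v) Pv.
Qed.

(** A left eigenvector [w] of [A + B *m K] either vanishes on the range of
[P], and then it does not see the input, so that it is also an eigenvector
for every other gain [K']; or it restricts to a nonzero linear form on this
range, which yields an eigenvalue of the closed loop projected there. *)
Lemma eigenvalue_extend (F : fieldType) (n m : nat) (A P : 'M[F]_n)
    (B : 'M[F]_(n, m)) (K : 'M[F]_(m, n)) (K' : 'M[F]_(m, n)) (z : F) :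
  P *m P = P -> P *m A *m P = A *m P -> P *m B = B -> z != 0 ->
  eigenvalue (A + B *m K) z ->
  eigenvalue (A *m P + B *m K) z \/ eigenvalue (A + B *m K') z.
Proof.
move=> PP PAP PB nz_z /eigenvalueP[w zw nz_w].
have [wP0 | nz_wP] := eqVneq (w *m P) 0.
  have wB : w *m B = 0 by rewrite -PB mulmxA wP0 mul0mx.
  right; apply/eigenvalueP; exists w => //.
  by rewrite -zw !mulmxDr !mulmxA wB !mul0mx.
(* [w *m P] is an eigenvector of [M0 *m P]; since [P *m M0 = M0], multiplying
   it by [M0] turns it into an eigenvector of [M0], as for products
   in either order. *)
left; set M0 := A *m P + B *m K; set y := w *m P.
have PM0 : P *m M0 = M0 by rewrite mulmxDr !mulmxA PAP PB.
have M0P : M0 *m P = (A + B *m K) *m P.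
  by rewrite !mulmxDl -(mulmxA A P P) PP.
have yM0P : y *m M0 *m P = z *: y.
  by rewrite -mulmxA -/y /y -mulmxA [P *m _]mulmxA PM0 M0P mulmxA zw scalemxAl.
apply/eigenvalueP; exists (y *m M0).
  by rewrite -{2}PM0 mulmxA yM0P scalemxAl.
apply: contraNneq nz_wP => yM0.
by have /eqP := yM0P; rewrite yM0 mul0mx eq_sym scaler_eq0 (negPf nz_z).
Qed.

Lemma stableP (R : realType) (n : nat) (M : 'M[R]_n) :
  (forall z : R[i], z != 0 ->
     eigenvalue (map_mx (real_complex R) M) z -> `|z| < 1) -> stable M.
Proof.
by move=> st z; have [->|] := eqVneq z 0; [rewrite normr0 | exact: st].
Qed.

Lemma stabilizes_restrict (R : realType) (n m : nat) (A P : 'M[R]_n)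
    (B : 'M[R]_(n, m)) (K : 'M[R]_(m, n)) :
  P *m A *m P = A *m P -> P *m B = B ->
  stabilizes A B K -> stabilizes (A *m P) B K.
Proof.
move=> PAP PB st; apply: stableP => z nz_z eig; apply: st; move: eig.
rewrite !map_mxD !map_mxM; apply: eigenvalue_restrict nz_z.
  by rewrite -!map_mxM PAP.
by rewrite -map_mxM PB.
Qed.

Lemma stabilizes_extend (R : realType) (n m : nat) (A P : 'M[R]_n)
    (B : 'M[R]_(n, m)) (K : 'M[R]_(m, n)) :
  P *m P = P -> P *m A *m P = A *m P -> P *m B = B ->
  stabilizable A B -> stabilizes (A *m P) B K -> stabilizes A B K.
Proof.
move=> PP PAP PB [K' st'] st; apply: stableP => z nz_z.
rewrite map_mxD map_mxM => eig.
pose rc := fun p q => @map_mx R R[i] (real_complex R) p q.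
have PPc : rc _ _ P *m rc _ _ P = rc _ _ P by rewrite /rc -map_mxM PP.
have PAPc : rc _ _ P *m rc _ _ A *m rc _ _ P = rc _ _ A *m rc _ _ P.
  by rewrite /rc -!map_mxM PAP.
have PBc : rc _ _ P *m rc _ _ B = rc _ _ B by rewrite /rc -map_mxM PB.
case: (eigenvalue_extend (rc _ _ K') PPc PAPc PBc nz_z eig) => eig'.
  by apply: st; rewrite map_mxD !map_mxM.
by apply: st'; rewrite map_mxD !map_mxM.
Qed.

(** * Linear maps on spans and orthogonal projections *)

Lemma mulmx_span (F : fieldType) (p q : nat) (M : 'M[F]_(p, q))
    (X : seq 'cV[F]_q) (W : {vspace 'cV[F]_p}) :
  (forall x, x \in X -> M *m x \in W) ->
  forall x, x \in <<X>>%VS -> M *m x \in W.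
Proof.
move=> MX x; suff /subvP sub : (<<X>> <= linfun (mulmx M) @^-1: W)%VS.
  by move=> /sub; rewrite -memv_preim lfunE.
by apply/span_subvP => y /MX; rewrite -memv_preim lfunE.
Qed.

Lemma mulmx_span0 (F : fieldType) (p q : nat) (M : 'M[F]_(p, q))
    (X : seq 'cV[F]_q) :
  (forall x, x \in X -> M *m x = 0) -> forall x, x \in <<X>>%VS -> M *m x = 0.
Proof.
move=> MX x /(@mulmx_span _ _ _ M X 0%VS) Mx.
by apply/eqP; rewrite -memv0; apply: Mx => y /MX ->; rewrite mem0v.
Qed.

Lemma mulmx_id_span (F : fieldType) (n : nat) (P : 'M[F]_n)
    (X : seq 'cV[F]_n) :
  (forall x, x \in X -> P *m x = x) -> forall x, x \in <<X>>%VS -> P *m x = x.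
Proof.
move=> PX x xX; apply/eqP; rewrite -subr_eq0 -{2}[x]mul1mx -mulmxBl.
apply/eqP; apply: mulmx_span0 xX => y yX.
by rewrite mulmxBl mul1mx PX ?subrr.
Qed.

Lemma mulmx_cV_inj (F : fieldType) (p q : nat) (M N : 'M[F]_(p, q)) :
  (forall v : 'cV_q, M *m v = N *m v) -> M = N.
Proof.
move=> MN; apply/matrixP => i j.
by have /matrixP/(_ i 0) := MN (delta_mx j 0); rewrite -!colE !mxE.
Qed.

Lemma frobenius_norm_sqr (R : realType) (p q : nat) (M : 'M[R]_(p, q)) :
  frobenius_norm M ^+ 2 = \tr (M *m M^T).
Proof.
rewrite sqr_sqrtr; last by do 2!apply: sumr_ge0 => ? _; rewrite sqr_ge0.
rewrite /mxtrace; apply: eq_bigr => i _; rewrite mxE.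
by apply: eq_bigr => j _; rewrite mxE expr2.
Qed.

Lemma frobenius_norm_sqr_eq0 (R : realType) (p q : nat) (M : 'M[R]_(p, q)) :
  frobenius_norm M ^+ 2 <= 0 -> M = 0.
Proof.
have row_ge0 i : 0 <= \sum_j M i j ^+ 2.
  by apply: sumr_ge0 => j _; rewrite sqr_ge0.
rewrite sqr_sqrtr ?sumr_ge0 // => le0.
have /eqP : \sum_i \sum_j M i j ^+ 2 = 0.
  by apply/eqP; rewrite eq_le le0 sumr_ge0.
rewrite psumr_eq0 // => /allP rows0; apply/matrixP => i j; rewrite mxE.
have := rows0 i (mem_index_enum i); rewrite psumr_eq0; last first.
  by move=> k _; rewrite sqr_ge0.
move=> /allP /(_ j (mem_index_enum j)); rewrite /= expf_eq0 /=.
by move=> /eqP.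
Qed.

(** Gram-Schmidt: adding a vector [x] to the family adds to [P] the projection
onto the line of the residual [x - P *m x], if this residual is nonzero. *)
Lemma orthogonal_projection (R : realType) (n : nat) (X : seq 'cV[R]_n) :
  exists P : 'M[R]_n, [/\ P^T = P, P *m P = P,
    forall x, x \in <<X>>%VS -> P *m x = x &
    forall y, P *m y \in <<X>>%VS].
Proof.
suff [P [PT PP PX PV]] : exists P : 'M[R]_n, [/\ P^T = P, P *m P = P,
    forall x, x \in X -> P *m x = x & forall y, P *m y \in <<X>>%VS].
  by exists P; split=> //; exact: mulmx_id_span.
elim: X => [|x X [P [PT PP PX PV]]].
  exists 0; split=> //; rewrite ?trmx0 ?mul0mx // => y.
  by rewrite mul0mx mem0v.
have PspanX v : P *m v \in <<x :: X>>%VS.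
  by rewrite span_cons; apply: subvP (PV v); rewrite addvSr.
pose r := x - P *m x.
have Pr : P *m r = 0 by rewrite mulmxBr mulmxA PP subrr.
have rP : r^T *m P = 0 by rewrite -PT -trmx_mul Pr trmx0.
have rX : r \in <<x :: X>>%VS by rewrite memvB // memv_span // mem_head.
have [r0 | nz_r] := eqVneq r 0.
  exists P; split=> // y; rewrite inE => /predU1P[->|/PX//].
  by apply/esym/eqP; rewrite -subr_eq0 -/r r0.
pose c := (r^T *m r) 0 0.
have rr : r^T *m r = c%:M by rewrite [LHS]mx11_scalar.
have nz_c : c != 0.
  apply: contraNneq nz_r => c0; rewrite -trmx_eq0; apply/eqP.
  apply: frobenius_norm_sqr_eq0.
  by rewrite frobenius_norm_sqr trmxK rr c0 /mxtrace big_ord1 mxE mul0rn.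
exists (P + c^-1 *: (r *m r^T)); split=> [|| y|y].
- by rewrite raddfD /= PT linearZ /= trmx_mul trmxK.
- rewrite mulmxDl !mulmxDr PP -!scalemxAr -!scalemxAl mulmxA Pr mul0mx.
  rewrite -[r *m r^T *m P]mulmxA rP mulmx0 !scaler0 addr0 add0r; congr (_ + _).
  rewrite -mulmxA [r^T *m (_ *m _)]mulmxA rr mul_scalar_mx -scalemxAr.
  by rewrite [c^-1 *: (c *: _)]scalerA mulVf // scale1r.
- rewrite mulmxDl -scalemxAl -mulmxA inE => /predU1P[->|yX].
    have -> : r^T *m x = c%:M.
      by rewrite -rr /r mulmxBr mulmxA -/r rP mul0mx subr0.
    by rewrite mul_mx_scalar scalerA mulVf // scale1r addrC subrK.
  by rewrite PX // -[in r^T *m y](PX y yX) [r^T *m _]mulmxA rP mul0mx mulmx0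
     scaler0 addr0.
- rewrite mulmxDl memvD // -scalemxAl memvZ // -mulmxA.
  by rewrite [r^T *m y]mx11_scalar mul_mx_scalar memvZ.
Qed.

Lemma frobenius_norm_pythagoras (R : realType) (p q : nat) (M : 'M[R]_(p, q))
    (P : 'M[R]_q) :
  P^T = P -> P *m P = P ->
  frobenius_norm M ^+ 2 =
  frobenius_norm (M *m P) ^+ 2 + frobenius_norm (M - M *m P) ^+ 2.
Proof.
move=> PT PP; rewrite !frobenius_norm_sqr -mxtraceD; congr (\tr _).
rewrite [(M - _)^T]raddfB /= trmx_mul PT mulmxBl !mulmxBr !mulmxA.
by rewrite -[M *m P *m P]mulmxA PP subrr subr0 addrC subrK.
Qed.

(** * Invariant of the exploration *)

Lemma unit_vec_delta (R : realType) (m : nat) (j : 'I_m) :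
  unit_vec R m j.+1 = delta_mx j 0.
Proof. by apply/matrixP => i k; rewrite !mxE ord1 eqSS andbT. Qed.

Lemma mulmx_unit_vec_eq0 (R : realType) (p m : nat) (F : 'M[R]_(p, m)) :
  (forall j, (0 < j <= m)%N -> F *m unit_vec R m j = 0) -> F = 0.
Proof.
move=> F0; apply/matrixP => i j; rewrite mxE.
have /matrixP/(_ i 0) := F0 j.+1 (ltn_ord j).
by rewrite unit_vec_delta -colE !mxE.
Qed.

(** [explored_annihilator] says dually that the span of the pairs [(x, u)] of
the data contains the product of the span of the past states with the span of
the unit inputs used so far: it speaks of the linear maps [(E, F)] that vanish on the data instead of
linear combinations of data. *)
Record explored (R : realType) (n m : nat) (A : 'M[R]_n) (B : 'M[R]_(n, m))
    (st : exploration R n m) : Prop := Explored {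
  explored_consistent : consistent (expl_data st) (A, B);
  explored_state : forall xp x u,
    expl_data st (xp, x, u) -> x \in <<expl_past st>>%VS;
  explored_annihilator : forall (p : nat) (E : 'M[R]_(p, n)) (F : 'M[R]_(p, m)),
    (forall xp x u, expl_data st (xp, x, u) -> E *m x + F *m u = 0) ->
    (forall x, x \in <<expl_past st>>%VS -> E *m x = 0) /\
    (forall j, (0 < j < expl_s st)%N -> F *m unit_vec R m j = 0);
  explored_A : forall x, x \in <<expl_past st>>%VS ->
    A *m x \in <<expl_x st :: expl_past st>>%VS;
  explored_B : forall j, (0 < j < expl_s st)%N ->
    B *m unit_vec R m j \in <<expl_x st :: expl_past st>>%VS
}.

Lemma explored_init (R : realType) (n m : nat) (A : 'M[R]_n)
    (B : 'M[R]_(n, m)) (x0 : 'cV[R]_n) :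
  explored A B (exploration_init m x0).
Proof.
split=> //=.
- move=> p E F _; split; last by case.
  by apply: mulmx_span0 => x; rewrite inE => /eqP ->; rewrite mulmx0.
- by move=> x; rewrite span_seq1 => /vlineP[c ->]; rewrite scaler0 mulmx0 mem0v.
- by case.
Qed.

(** When the state [x] is new, the input is 0 and the datum gives [E *m x = 0].
When [x] lies in the past span, [E *m x = 0] is already known, so the datum
gives [F *m e_s = 0]; likewise [A *m x] is already known to lie in the span of
the visited states, so [B *m e_s], the difference of the successor of [x] and
[A *m x], lies in the span as soon as this successor is added. *)
Lemma explored_step (R : realType) (n m : nat) (A : 'M[R]_n)
    (B : 'M[R]_(n, m)) (st st' : exploration R n m) :
  explored A B st -> exploration_step A B st = Some st' -> explored A B st'.
Proof.
case: st => x past s D [/= cons sta ann spA spB].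
have sub y : y \in <<past>>%VS -> y \in <<x :: past>>%VS.
  by rewrite span_cons; apply/subvP; rewrite addvSr.
have subs xp y : y \in <<x :: past>>%VS -> y \in <<[:: xp, x & past]>>%VS.
  by rewrite [in X in _ -> X]span_cons; apply/subvP; rewrite addvSr.
have xpP xp : xp \in <<[:: xp, x & past]>>%VS.
  by rewrite memv_span // mem_head.
have cons' u : consistent (D `|` [set (A *m x + B *m u, x, u)]) (A, B).
  by move=> xp y v [/cons//|[-> -> ->]].
have sta' (u : 'cV[R]_m) xp y v :
    (D `|` [set (A *m x + B *m u, x, u)]) (xp, y, v) -> y \in <<x :: past>>%VS.
  by move=> [/sta/sub//|[_ -> _]]; rewrite memv_span // mem_head.
rewrite /exploration_step /=; case: ifPn => xin.
  case: ltnP => // le_s [<-]; split=> //=.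
  + exact: sta'.
  + move=> p E F EF0.
    have [|E0 F0] := ann p E F.
      by move=> xp y v Dy; apply: (EF0 xp); left.
    have Ex := E0 x xin; split.
      apply: mulmx_span0 => y; rewrite inE => /predU1P[->//|yp].
      by rewrite E0 // memv_span.
    move=> j /andP[j_gt0]; rewrite ltnS leq_eqVlt => /predU1P[->|lt_j].
      have := EF0 _ x (unit_vec R m s) (or_intror erefl).
      by rewrite Ex add0r.
    by rewrite F0 // j_gt0.
  + apply: mulmx_span => y; rewrite inE => /predU1P[->|yp].
      by apply: subs; apply: spA.
    by apply: subs; apply: spA; rewrite memv_span.
  + move=> j /andP[j_gt0]; rewrite ltnS leq_eqVlt => /predU1P[->|lt_j].
      set xp := A *m x + _.
      have -> : B *m unit_vec R m s = xp - A *m x by rewrite addrC addKr.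
      by rewrite memvB ?xpP ?subs ?spA.
    by apply: subs; apply: spB; rewrite j_gt0.
case=> <-; split=> //=.
+ exact: sta'.
+ move=> p E F EF0.
  have [|E0 F0] := ann p E F.
    by move=> xp y v Dy; apply: (EF0 xp); left.
  split=> //; apply: mulmx_span0 => y; rewrite inE => /predU1P[->|yp].
    have := EF0 _ x 0 (or_intror erefl).
    by rewrite mulmx0 addr0.
  by rewrite E0 // memv_span.
+ apply: mulmx_span => y; rewrite inE => /predU1P[->|yp].
    (* the successor of [x] is written [A *m x + B *m 0] *)
    by rewrite -{1}[A *m x]addr0 -(mulmx0 _ B) xpP.
  by apply: subs; apply: spA; rewrite memv_span.
+ by move=> j /spB/subs.
Qed.

(** At the stop the current state lies in the past span, which is therefore
invariant, and all [m] unit inputs have been used. Applying the annihilator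
property to the difference of two consistent pairs identifies them on the
span. *)
Lemma fast_exploration_informative (R : realType) (n m : nat)
    (A : 'M[R]_n) (B : 'M[R]_(n, m)) (x0 : 'cV[R]_n) (D : set (datum R n m)) :
  fast_exploration A B x0 D ->
  exists X : seq 'cV[R]_n, [/\
    forall x, x \in <<X>>%VS -> A *m x \in <<X>>%VS,
    forall u, B *m u \in <<X>>%VS &
    forall AB : 'M[R]_n * 'M[R]_(n, m), consistent D AB <->
      (forall x, x \in <<X>>%VS -> AB.1 *m x = A *m x) /\ AB.2 = B].
Proof.
rewrite /fast_exploration; move: (explored_init A B x0).
move: (exploration_init m x0) => st inv ret; elim: ret inv => {st D}; last first.
  by move=> st st' D step _ IH inv; apply: IH; apply: explored_step inv step.
move=> st; rewrite /exploration_step; case: ifP => // xin.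
case: ltnP => // lt_ms _ [cons sta ann spA spB].
have eq_span : <<expl_x st :: expl_past st>>%VS = <<expl_past st>>%VS.
  by rewrite span_cons; apply/addv_idPr; rewrite -memvE.
rewrite eq_span in spA spB.
exists (expl_past st); split=> // [u|[A' B'] /=].
  rewrite [u]matrix_sum_delta mulmx_sumr memv_suml // => j _.
  rewrite big_ord1 -scalemxAr memvZ // -unit_vec_delta spB //=.
  exact: leq_ltn_trans lt_ms.
split=> [cons'|[eqA ->] xp x u Dx]; last first.
  by rewrite (cons _ _ _ Dx) /= eqA //; apply: sta Dx.
have [|E0 F0] := ann n (A' - A) (B' - B).
  move=> xp x u Dx; rewrite !mulmxBl addrACA -opprD.
  by rewrite -(cons' _ _ _ Dx) -(cons _ _ _ Dx) subrr.
split=> [x /E0/eqP|]; first by rewrite mulmxBl subr_eq0 => /eqP.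
apply/eqP; rewrite -subr_eq0; apply/eqP.
apply: mulmx_unit_vec_eq0 => j /andP[j_gt0 le_jm]; apply: F0.
by rewrite j_gt0 (leq_ltn_trans le_jm).
Qed.

(** * The pseudo estimate *)

(** The part of a consistent state matrix inside the range of [P] is
prescribed, and by Pythagoras the remaining part only adds to the norm; it is
0 for the minimizer, and only for it. *)
Lemma pseudo_estimate_projection (R : realType) (n m : nat)
    (A : 'M[R]_n) (B : 'M[R]_(n, m)) (D : set (datum R n m)) (P : 'M[R]_n) :
  P^T = P -> P *m P = P ->
  (forall AB : 'M[R]_n * 'M[R]_(n, m),
     consistent D AB <-> AB.1 *m P = A *m P /\ AB.2 = B) ->
  pseudo_estimate D = (A *m P, B).
Proof.
move=> PT PP consE.
have consAP : consistent D (A *m P, B).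
  by apply/consE; split=> //=; rewrite -mulmxA PP.
apply: xget_unique => [|[A' B'] [/consE[/= A'P ->] /(_ _ consAP)/=]].
  split=> // -[A' B'] /consE[/= A'P ->]; rewrite lerD2r.
  by rewrite (frobenius_norm_pythagoras A' PT PP) A'P lerDl sqr_ge0.
rewrite lerD2r (frobenius_norm_pythagoras A' PT PP) A'P gerDl.
by move=> /frobenius_norm_sqr_eq0/eqP; rewrite subr_eq0 => /eqP ->.
Qed.

Theorem theorem1 (R : realType) (n m : nat)
    (A : 'M[R]_n) (B : 'M[R]_(n, m)) (x0 : 'cV[R]_n)
    (D : set (datum R n m)) :
  stabilizable A B ->
  fast_exploration A B x0 D ->
  let A0 := (pseudo_estimate D).1 in
  let B0 := (pseudo_estimate D).2 in
  stabilizable A0 B0 /\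
  (forall K : 'M[R]_(m, n), stabilizes A0 B0 K -> stabilizes A B K).
Proof.
move=> stab /fast_exploration_informative[X [AX BX consE]].
have [P [PT PP PX PV]] := orthogonal_projection X.
have PAP : P *m A *m P = A *m P.
  by apply: mulmx_cV_inj => v; rewrite -!mulmxA PX // AX.
have PB : P *m B = B.
  by apply: mulmx_cV_inj => v; rewrite -mulmxA PX.
rewrite (@pseudo_estimate_projection _ _ _ A B D P PT PP) /=.
  split; last by move=> K; apply: stabilizes_extend.
  by have [K stK] := stab; exists K; apply: stabilizes_restrict.
move=> AB; rewrite consE; split=> -[eqA ->]; split=> //.
  by apply: mulmx_cV_inj => v; rewrite -!mulmxA eqA.
by move=> x /PX <-; rewrite !mulmxA eqA.
Qed.
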